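(* Let $q\ge 2$ be an integer and suppose that a finite projective plane $\Pi_{q^2}$ of order $q^2$ contains a Baer subplane $\Pi_q$ (a subplane of order $q$). Then there exists an extremal bipartite $$egr\bigl(2(q^4-q),\, q^2,\, 6,\, (q^2-1)(q^4-3q^2+q+2)\bigr),$$ i.e. a bipartite edge-girth-regular graph with these parameters whose order $2(q^4-q)$ equals $n_2\bigl(q^2,6,(q^2-1)(q^4-3q^2+q+2)\bigr)$. If $q$ is odd, then this graph is also an extremal egr-graph, i.e. $2(q^4-q)=n\bigl(q^2,6,(q^2-1)(q^4-3q^2+q+2)\bigr)$.
   Context: All graphs are simple, finite and connected. A $(k,g)$-graph is a $k$-regular graph of girth $g$. An edge-girth-regular graph $egr(n,k,g,\lambda)$ is a $(k,g)$-graph on $n$ vertices in which every edge is contained in exactly $\lambda$ distinct cycles of length $g$. For a triple $(k,g,\lambda)$, $n(k,g,\lambda)$ denotes the smallest order of an $egr(n,k,g,\lambda)$, and $n_2(k,g,\lambda)$ denotes the smallest order of a bipartite $egr(n,k,g,\lambda)$. An $egr(n,k,g,\lambda)$ is extremal if $n=n(k,g,\lambda)$; a bipartite one is extremal bipartite if $n=n_2(k,g,\lambda)$. *)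

(* Defs.v *)
From mathcomp Require Import all_boot.

Set Implicit Arguments.
Unset Strict Implicit.
Unset Printing Implicit Defensive.

Record sgraph := SGraph {
  vertex :> finType;
  adj : rel vertex;
  adj_sym : symmetric adj;
  adj_irrefl : irreflexive adj
}.

Section Graph.
Variable G : sgraph.
Implicit Types (k g n lam : nat) (s : seq G).

Definition connected_graph : Prop := forall x y : G, connect (@adj G) x y.

Definition regular_graph k : Prop :=
  forall x : G, #|[set y | adj x y]| = k.

Definition bipartite : Prop :=
  exists side : G -> bool, forall x y : G, adj x y -> side x != side y.

(* The lower bound on the size is needed because [:: x; y] is a duplicate-free
   cyclic sequence whenever x and y are adjacent. *)
Definition cycle_seq s : bool := (2 < size s) && ucycleb (@adj G) s.

Definition has_girth g : Prop :=
  (exists s, cycle_seq s /\ size s = g) /\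
  (forall s, cycle_seq s -> g <= size s).

(* A cycle, as a subgraph, is identified with its set of edges, so that the
   choice of a starting vertex and of a direction is immaterial when cycles are
   counted. *)
Definition cycle_edges s : {set {set G}} := [set [set x; next s x] | x in s].

Definition cycles_of_length g : {set {set {set G}}} :=
  [set cycle_edges t | t : g.-tuple G & cycle_seq t].

Definition egr n k g lam : Prop :=
  [/\ connected_graph, #|G| = n, regular_graph k, has_girth g &
      forall x y : G, adj x y ->
        #|[set C in cycles_of_length g | [set x; y] \in C]| = lam].

End Graph.

Definition is_least (P : nat -> Prop) (n : nat) : Prop :=
  P n /\ forall m, P m -> n <= m.

(* "n = n(k,g,lam)", in relational form since no such graph need exist. *)
Definition min_order (k g lam n : nat) : Prop :=
  is_least (fun m => exists H : sgraph, egr H m k g lam) n.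

(* "n = n_2(k,g,lam)". *)
Definition min_order2 (k g lam n : nat) : Prop :=
  is_least (fun m => exists H : sgraph, bipartite H /\ egr H m k g lam) n.

Definition extremal_egr (G : sgraph) (n k g lam : nat) : Prop :=
  egr G n k g lam /\ min_order k g lam n.

Definition extremal_bipartite_egr (G : sgraph) (n k g lam : nat) : Prop :=
  [/\ bipartite G, egr G n k g lam & min_order2 k g lam n].

Record incidence_structure := IncidenceStructure {
  point : finType;
  line : finType;
  inc : point -> line -> bool
}.

Definition projective_plane (S : incidence_structure) : Prop :=
  [/\ forall x y : point S, x != y -> exists! l : line S, inc x l /\ inc y l,
      forall l m : line S, l != m -> exists! x : point S, inc x l /\ inc x m &
      exists Q : {set point S},
        #|Q| = 4 /\ forall l : line S, #|[set x in Q | inc x l]| <= 2].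

Definition projective_plane_of_order (m : nat) (S : incidence_structure)
    : Prop :=
  projective_plane S /\ forall l : line S, #|[set x | inc x l]| = m.+1.

Definition induced (S : incidence_structure)
    (P0 : {set point S}) (L0 : {set line S}) : incidence_structure :=
  @IncidenceStructure {x : point S | x \in P0} {l : line S | l \in L0}
    (fun x l => inc (val x) (val l)).

Definition subplane_of_order (q : nat) (S : incidence_structure)
    (P0 : {set point S}) (L0 : {set line S}) : Prop :=
  projective_plane_of_order q (induced P0 L0).

(* Main.v *)
(* Delete from the plane the points and lines of its Baer subplane and take the
   incidence graph of what remains. Counting shows that a point (line) outside a
   Baer subplane is incident with exactly one Baer line (point); this yields the
   degree q^2 and the order.

   For an edge xy of a k-regular graph of girth 6 the vertices at distance at most 2
   from the edge form a tree, and the 6-cycles through xy are the edges joining its two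
   sets of leaves, at distance 2 from y and from x. The remaining edges at the leaves
   near y, of which there are (k - 1)^3 - lambda, therefore leave the tree. This gives
   lambda for the Baer graph. A vertex outside the tree is adjacent to at most
   k - 1 leaves on either side, hence to at most k - 1 leaves if the graph is bipartite
   and to at most k in general, so the number of outside vertices is bounded below. *)
Require Import Defs.
From mathcomp Require Import all_boot.
From mathcomp Require Import zify.

Set Implicit Arguments.
Unset Strict Implicit.
Unset Printing Implicit Defensive.

(** * Counting incidences in two ways *)

Section DoubleCounting.
Variables (T U : finType) (A : {set T}) (B : {set U}) (R : T -> U -> bool).

Lemma double_count :
  \sum_(a in A) #|[set b in B | R a b]| = \sum_(b in B) #|[set a in A | R a b]|.
Proof.
have card_if (V : finType) (C : {set V}) (P : pred V) :
    #|[set c in C | P c]| = \sum_(c in C) P c.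
  rewrite -sum1_card (eq_bigl (fun c => (c \in C) && P c)); last first.
    by move=> c; rewrite inE.
  by rewrite big_mkcondr; apply: eq_bigr => c _; case: (P c).
under eq_bigr do rewrite card_if.
under [in RHS]eq_bigr do rewrite card_if.
exact: exchange_big.
Qed.

Lemma double_count_eq r s :
  (forall a, a \in A -> #|[set b in B | R a b]| = r) ->
  (forall b, b \in B -> #|[set a in A | R a b]| = s) ->
  #|A| * r = #|B| * s.
Proof.
by move=> Ar Bs; rewrite -!sum_nat_const -(eq_bigr _ Ar) -(eq_bigr _ Bs) double_count.
Qed.

Lemma double_count_le r s :
  (forall a, a \in A -> #|[set b in B | R a b]| = r) ->
  (forall b, b \in B -> #|[set a in A | R a b]| <= s) ->
  #|A| * r <= #|B| * s.
Proof.
by move=> Ar Bs; rewrite -!sum_nat_const -(eq_bigr _ Ar) double_count leq_sum.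
Qed.

Lemma card_pairs :
  #|[set t : T * U | [&& t.1 \in A, t.2 \in B & R t.1 t.2]]| =
    \sum_(a in A) #|[set b in B | R a b]|.
Proof.
rewrite -sum1_card.
rewrite (eq_bigl (fun t : T * U => (t.1 \in A) && ((t.2 \in B) && R t.1 t.2))); last first.
  by move=> t; rewrite inE.
rewrite -(pair_big_dep (mem A) (fun a b => (b \in B) && R a b) (fun _ _ => 1)) /=.
by apply: eq_bigr => a _; rewrite -sum1_card; apply: eq_bigl => b; rewrite inE.
Qed.

End DoubleCounting.

Lemma card_eq1 (T : finType) (A : {set T}) x :
  x \in A -> (forall y, y \in A -> y = x) -> #|A| = 1.
Proof.
move=> xA Ax; rewrite (_ : A = [set x]) ?cards1 //.
by apply/setP => y; rewrite inE; apply/idP/eqP => [/Ax|->].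
Qed.

Lemma eq_set2 (T : finType) (a b c d : T) :
  [set a; b] = [set c; d] -> (a = c /\ b = d) \/ (a = d /\ b = c).
Proof.
move=> E; have := set21 a b; have := set22 a b; rewrite E => /set2P b_cd /set2P a_cd.
have := set21 c d; have := set22 c d; rewrite -E => /set2P d_ab /set2P c_ab.
by move: a_cd b_cd c_ab d_ab; intuition congruence.
Qed.

(** * Six-cycles as sets of edges *)

Section Cycles.
Variable G : sgraph.
Implicit Types (s : seq G).

Lemma cycle_seq_rot n s : cycle_seq (rot n s) = cycle_seq s.
Proof. by rewrite /cycle_seq /ucycleb size_rot rot_cycle rot_uniq. Qed.

Lemma cycle_seq_rev s : cycle_seq (rev s) = cycle_seq s.
Proof.
rewrite /cycle_seq /ucycleb size_rev rev_uniq rev_cycle.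
by rewrite (eq_cycle (e' := @adj G)) // => x y; rewrite /= adj_sym.
Qed.

Lemma cycle_seq_uniq s : cycle_seq s -> uniq s.
Proof. by case/and3P. Qed.

Lemma cycle_edges_rot n s : uniq s -> cycle_edges (rot n s) = cycle_edges s.
Proof.
move=> Us; apply/setP => E; apply/imsetP/imsetP => -[x xs ->];
  by exists x; rewrite ?next_rot // ?mem_rot in xs *.
Qed.

Lemma cycle_edges_rev s : uniq s -> cycle_edges (rev s) = cycle_edges s.
Proof.
move=> Us; apply/setP => E; apply/imsetP/imsetP => -[x xs ->].
  rewrite mem_rev in xs; exists (prev s x); first by rewrite mem_prev.
  by rewrite next_rev // next_prev // setUC.
exists (next s x); first by rewrite mem_rev mem_next.
by rewrite next_rev // prev_next // setUC.
Qed.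

(** [t.1] is the branch behind [y] and [t.2] the branch behind [x], so the edge opposite to [x]-[y]
    is [t.1.2]-[t.2.1]. *)
Definition hexagon (x y : G) (t : (G * G) * (G * G)) : seq G :=
  [:: x; y; t.1.1; t.1.2; t.2.1; t.2.2].

Lemma mem_cycle_edges s u v :
  uniq s -> [set u; v] \in cycle_edges s -> v = next s u \/ v = prev s u.
Proof.
move=> Us /imsetP[w _ /eq_set2[] [-> ->]]; first by left.
by right; rewrite prev_next.
Qed.

Lemma next_mem_cycle_edges s u : u \in s -> [set u; next s u] \in cycle_edges s.
Proof. by move=> us; apply/imsetP; exists u. Qed.

Lemma next_hexagon (x y a b c d : G) (s := [:: x; y; a; b; c; d]) : uniq s ->
  [/\ next s x = y, next s y = a, next s a = b & next s b = c /\ next s c = d].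
Proof.
rewrite {}/s => U; set s := [:: x; y; a; b; c; d].
(* [next] reduces without further tests at the head of a sequence, so each vertex in turn is rotated
   to the front. *)
have rotE n : next s =1 next (rot n s) by move=> z; rewrite next_rot.
by split; last split; [rewrite (rotE 0)|rewrite (rotE 1)|rewrite (rotE 2)|
  rewrite (rotE 3)|rewrite (rotE 4)]; rewrite /= eqxx.
Qed.

Lemma mem_cycles_of_length6 x y (C : {set {set G}}) :
  reflect (exists2 t, cycle_seq (hexagon x y t) & C = cycle_edges (hexagon x y t))
    ((C \in cycles_of_length G 6) && ([set x; y] \in C)).
Proof.
apply: (iffP andP) => [[/imsetP[s + ->] /imsetP[z zs]]|[t t_cyc ->]].
  rewrite inE; case: s zs => s /= /eqP s6 zs s_cyc.
  have Us := cycle_seq_uniq s_cyc.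
  case: (rot_to zs) => i s' rot_s; rewrite -(next_rot i Us) -(cycle_edges_rot i Us).
  move: s6 s_cyc Us; rewrite -(size_rot i) -(cycle_seq_rot i) -(rot_uniq i) rot_s.
  case: s' {rot_s} => [|w [|a [|b [|c [|d []]]]]] //= _.
  rewrite eqxx => t_cyc _ /eq_set2[] [xE yE]; rewrite -{}xE -{}yE {z w zs} in t_cyc *.
    by exists ((a, b), (c, d)).
  (* Here the cycle traverses the edge from [y] to [x], so it has to be reversed before it can start
     with [x] and [y]. *)
  exists ((d, c), (b, a)); first by rewrite -cycle_seq_rev -(cycle_seq_rot 4).
  have Ut := cycle_seq_uniq t_cyc.
  by rewrite -(cycle_edges_rev Ut) -(cycle_edges_rot 4) // rev_uniq.
have [nx _ _ _] := next_hexagon (cycle_seq_uniq t_cyc).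
split; last by rewrite -{1}nx; apply: next_mem_cycle_edges; rewrite inE eqxx.
by apply/imsetP; exists [tuple of hexagon x y t]; rewrite ?inE.
Qed.

(** With [x] and [y] fixed the edge set determines the traversal: of the two edges at a vertex one
    was used to arrive, so the other leads on. *)
Lemma cycle_edges_hexagon_inj x y :
  {in [set t | cycle_seq (hexagon x y t)] &,
    injective (fun t => cycle_edges (hexagon x y t))}.
Proof.
move=> [[a b] [c d]] [[a' b'] [c' d']]; rewrite !inE.
move=> /cycle_seq_uniq U /cycle_seq_uniq U'.
set s := hexagon x y (a, b, (c, d)) in U *; set s' := hexagon x y (a', b', (c', d')) in U' *.
move=> E; have [nx ny na [nb nc]] := @next_hexagon x y a b c d U.
have [nx' ny' na' [nb' nc']] := @next_hexagon x y a' b' c' d' U'.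
rewrite -/s in nx ny na nb nc; rewrite -/s' in nx' ny' na' nb' nc'.
have step p u v : next s p = u -> next s' p = u -> next s u = v -> u \in s -> p != v ->
    v = next s' u.
  move=> pu pu' uv us p_ne; have := next_mem_cycle_edges us; rewrite E uv.
  case/(mem_cycle_edges U') => // vE.
  by move: p_ne; rewrite vE -pu' prev_next // eqxx.
move: (U); rewrite /s /= !inE !negb_or -!andbA.
case/and5P=> _ xa _ _ /and5P[_ _ yb _] /and5P[_ _ ac _] /and4P[_ bd _ _].
have ? : a = a' by rewrite -ny'; apply: (step x); rewrite // !inE eqxx ?orbT.
subst a'; have ? : b = b' by rewrite -na'; apply: (step y); rewrite // !inE eqxx ?orbT.
subst b'; have ? : c = c' by rewrite -nb'; apply: (step a); rewrite // !inE eqxx ?orbT.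
subst c'; have ? : d = d' by rewrite -nc'; apply: (step b); rewrite // !inE eqxx ?orbT.
by subst d'.
Qed.

Lemma card_cycles_of_length6 x y :
  #|[set C in cycles_of_length G 6 | [set x; y] \in C]| =
    #|[set t | cycle_seq (hexagon x y t)]|.
Proof.
rewrite -(card_in_imset (@cycle_edges_hexagon_inj x y)); apply: eq_card => C.
rewrite inE; apply/mem_cycles_of_length6/imsetP => -[t].
  by exists t; rewrite ?inE.
by rewrite inE; exists t.
Qed.

End Cycles.

(** * Regular graphs of girth six *)

Lemma adj_neq (G : sgraph) (x y : G) : adj x y -> x != y.
Proof. by apply: contraTneq => ->; rewrite adj_irrefl. Qed.

(* For an edge [x]-[y], [nbr x y] and [nbr2 x y] are the first two levels below [y] of the
   tree grown from that edge, i.e. on the side away from [x]. *)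
Definition nbr (G : sgraph) (x y : G) : {set G} := [set a | adj y a] :\ x.

Definition nbr2 (G : sgraph) (x y : G) : {set G} :=
  [set b | [exists a in nbr x y, adj a b && (b != y)]].

Definition half_tree (G : sgraph) (x y : G) : {set G} := y |: (nbr x y :|: nbr2 x y).

Definition outside (G : sgraph) (x y : G) : {set G} := ~: (half_tree x y :|: half_tree y x).

Definition nbr2_degree (G : sgraph) (x y c : G) : nat := #|[set b in nbr2 x y | adj b c]|.

Lemma in_nbr (G : sgraph) (x y a : G) : (a \in nbr x y) = (a != x) && adj y a.
Proof. by rewrite !inE. Qed.

Lemma nbr2P (G : sgraph) (x y b : G) :
  reflect (exists a, [/\ adj y a, a != x, adj a b & b != y]) (b \in nbr2 x y).
Proof.
rewrite inE; apply: (iffP exists_inP) => [[a]|[a [ya ax ab b_y]]].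
  by rewrite !inE => /andP[ax ya] /andP[ab b_y]; exists a.
by exists a; rewrite ?inE ?ax ?ya ?ab.
Qed.

Lemma outsideC (G : sgraph) (x y : G) : outside x y = outside y x.
Proof. by rewrite /outside setUC. Qed.

Section GirthSix.
Variables (G : sgraph) (p : nat).
Hypothesis girth6 : forall s : seq G, cycle_seq s -> 6 <= size s.
Hypothesis regular : regular_graph G p.+1.
Implicit Types a b c d u v w x y z : G.

Lemma no_triangle x y z : adj x y -> adj y z -> adj z x -> False.
Proof.
move=> xy yz zx; have := girth6 (s := [:: x; y; z]).
rewrite /cycle_seq /ucycleb /= xy yz zx !inE negb_or (adj_neq xy) (adj_neq yz).
by rewrite eq_sym (adj_neq zx) => /(_ isT).
Qed.

Lemma no_quadrangle x y z t :
  adj x y -> adj y z -> adj z t -> adj t x -> x != z -> y = t.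
Proof.
move=> xy yz zt tx xz; apply/eqP/negPn/negP => y_t.
have := girth6 (s := [:: x; y; z; t]).
rewrite /cycle_seq /ucycleb /= xy yz zt tx !inE !negb_or (adj_neq xy) (adj_neq yz).
by rewrite (adj_neq zt) xz y_t eq_sym (adj_neq tx) => /(_ isT).
Qed.

Lemma no_pentagon x y z t u :
  adj x y -> adj y z -> adj z t -> adj t u -> adj u x -> False.
Proof.
move=> xy yz zt tu ux; have := girth6 (s := [:: x; y; z; t; u]).
have xz : x != z by apply/eqP => E; subst z; apply: (@no_triangle x t u).
have xt : x != t by apply/eqP => E; subst t; apply: (@no_triangle x y z).
have y_t : y != t by apply/eqP => E; subst t; apply: (@no_triangle y u x).
have yu : y != u by apply/eqP => E; subst u; apply: (@no_triangle y z t).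
have zu : z != u by apply/eqP => E; subst u; apply: (@no_triangle z x y).
rewrite /cycle_seq /ucycleb /= xy yz zt tu ux !inE !negb_or (adj_neq xy) (adj_neq yz).
by rewrite (adj_neq zt) (adj_neq tu) xz xt y_t yu zu eq_sym (adj_neq ux) => /(_ isT).
Qed.

Lemma card_nbr x y : adj x y -> #|nbr x y| = p.
Proof.
move=> xy; have := cardsD1 x [set a | adj y a].
by rewrite regular inE adj_sym xy => -[].
Qed.

Lemma card_nbr_adj x y b : b \in nbr2 x y -> #|[set a in nbr x y | adj a b]| = 1.
Proof.
move=> /nbr2P[a [ya ax ab b_y]]; apply: (card_eq1 (x := a)).
  by rewrite !inE ax ya ab.
move=> a'; rewrite !inE => /andP[/andP[_ ya'] a'b].
by apply: (@no_quadrangle y a' b a) => //; [rewrite adj_sym|rewrite adj_sym|rewrite eq_sym].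
Qed.

Lemma card_nbr2 x y : adj x y -> #|nbr2 x y| = p * p.
Proof.
move=> xy; rewrite -{1}(card_nbr xy) -[LHS]muln1.
apply/esym/(double_count_eq (R := fun a b => adj a b)) => [a|b]; last exact: card_nbr_adj.
rewrite !inE => /andP[ax ya].
rewrite -(@card_nbr y a) //; apply: eq_card => b; rewrite !inE.
apply/andP/andP => [[/exists_inP[a' _ /andP[]] //]|[b_y ab]].
by split=> //; apply/exists_inP; exists a; rewrite ?inE ?ax ?ya ?ab ?b_y.
Qed.

Lemma half_treeP x y z :
  reflect [\/ z = y, adj y z /\ z != x | z \in nbr2 x y] (z \in half_tree x y).
Proof.
apply: (iffP setU1P) => [[->|/setUP[/setD1P[zx]|]]|[->|[yz zx]|z2]].
- by constructor 1.
- by rewrite inE; constructor 2.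
- by constructor 3.
- by left.
- by right; apply/setUP; left; apply/setD1P; rewrite inE.
- by right; apply/setUP; right.
Qed.

(** Each of the nine pairs of levels at which a common vertex could lie gives a closed walk of
    length at most 5 through the edge, which girth 6 or a side condition excludes. *)
Lemma half_tree_disjoint x y : adj x y -> [disjoint half_tree x y & half_tree y x].
Proof.
move=> xy; have yx : adj y x by rewrite adj_sym.
rewrite -setI_eq0; apply/eqP/setP => z; rewrite [RHS]inE; apply/negP.
move=> /setIP[/half_treeP[zy|[yz zx]|/nbr2P[a [ya ax az zy]]]
  /half_treeP[zx'|[xz zy']|/nbr2P[d [xd dy dz zx']]]].
- by subst; rewrite adj_irrefl in xy.
- by subst; rewrite eqxx in zy'.
- by subst; apply: (no_triangle xd dz yx).
- by subst; rewrite eqxx in zx.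
- by apply: (no_triangle xz _ yx); rewrite adj_sym.
- have zy : adj z y by rewrite adj_sym.
  by move: dy; rewrite (no_quadrangle xd dz zy yx) ?eqxx // eq_sym.
- by subst; apply: (no_triangle ya az xy).
- have zx : adj z x by rewrite adj_sym.
  by move: ax; rewrite (no_quadrangle ya az zx xy) ?eqxx // eq_sym.
- have zd : adj z d by rewrite adj_sym.
  by apply: (no_pentagon ya az zd _ xy); rewrite adj_sym.
Qed.

Lemma card_half_tree x y : adj x y -> #|half_tree x y| = 1 + p + p * p.
Proof.
move=> xy; rewrite cardsU1 cardsU card_nbr // card_nbr2 //.
have -> : y \notin nbr x y :|: nbr2 x y.
  apply/negP => /setUP[]; first by rewrite in_nbr adj_irrefl andbF.
  by case/nbr2P => a []; rewrite eqxx.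
rewrite (_ : nbr x y :&: nbr2 x y = set0) ?cards0 ?subn0 ?addnA //.
apply/setP => z; rewrite [RHS]inE; apply/negP => /setIP[].
rewrite in_nbr => /andP[_ yz] /nbr2P[a [ya _ az _]].
by apply: (no_triangle ya az); rewrite adj_sym.
Qed.

Lemma card_outside x y : adj x y -> #|G| = 2 * (1 + p + p * p) + #|outside x y|.
Proof.
move=> xy; have yx : adj y x by rewrite adj_sym.
rewrite -(cardsC (half_tree x y :|: half_tree y x)) cardsU !card_half_tree //.
by rewrite (disjoint_setI0 (half_tree_disjoint xy)) cards0 -/(outside x y); lia.
Qed.

(** With the next lemma this sorts the neighbours of a leaf [b]: its parent, leaves of the other
    half tree, and outside vertices. Anything else closes a cycle of length at most 5. *)
Lemma nbr2_adj_half_tree x y b c : adj x y -> b \in nbr2 x y -> adj b c ->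
  (c \in half_tree x y) = (c \in nbr x y).
Proof.
move=> xy /nbr2P[a [ya ax ab b_y]] bc; apply/idP/idP => [/half_treeP[cy|[yc cx]|]|].
- by subst; case: (no_triangle ya ab bc).
- by rewrite !inE cx yc.
- case/nbr2P => a' [ya' _ a'c _].
  by case: (no_pentagon ya ab bc (_ : adj c a')); rewrite adj_sym.
- by rewrite in_nbr => /andP[cx yc]; apply/half_treeP; constructor 2.
Qed.

Lemma nbr2_adj_half_tree' x y b c : adj x y -> b \in nbr2 x y -> adj b c ->
  (c \in half_tree y x) = (c \in nbr2 y x).
Proof.
move=> xy b2 bc; apply/idP/idP => [/half_treeP[cx|[xc cy]|//]|c2].
- subst; move: b2 => /nbr2P[a [ya ax ab b_y]].
  by move: ax; rewrite (no_quadrangle ya ab bc xy) ?eqxx // eq_sym.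
- move: b2 => /nbr2P[a [ya ax ab b_y]].
  by case: (no_pentagon ya ab bc (_ : adj c x) xy); rewrite adj_sym.
- by apply/half_treeP; constructor 3.
Qed.

Lemma hexagon_path x y a b c d : cycle_seq (hexagon x y ((a, b), (c, d))) ->
  [/\ [/\ adj y a, a != x, adj a b & b != y], [/\ adj x d, d != y, adj d c & c != x] & adj b c].
Proof.
rewrite /cycle_seq /ucycleb /= !inE !negb_or -!andbA.
case/and5P=> _ ya ab bc /and5P[cd dx _ _] /and5P[xa _ xc _] /and5P[_ yb _ yd _].
by split=> //; split=> //; rewrite 1?adj_sym // 1?eq_sym.
Qed.

(** A hexagon through the edge is determined by its opposite edge: [a] and [d] are the parents of
    the leaves [b] and [c]. *)
Lemma card_hexagons x y : adj x y ->
  #|[set t | cycle_seq (hexagon x y t)]| =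
    \sum_(b in nbr2 x y) #|[set c in nbr2 y x | adj b c]|.
Proof.
move=> xy; have yx : adj y x by rewrite adj_sym.
have uniq_mid u v w (v' : G) : adj u v -> adj v w -> adj u v' -> adj v' w -> w != u -> v = v'.
  by move=> uv vw uv' v'w wu; apply: (@no_quadrangle u v w v') => //;
    rewrite 1?adj_sym // eq_sym.
rewrite -card_pairs.
have inj : {in [set t | cycle_seq (hexagon x y t)] &, injective (fun t => (t.1.2, t.2.1))}.
  move=> [[a b] [c d]] [[a' b'] [c' d']]; rewrite !inE.
  move=> /hexagon_path[[ya _ ab b_y] [xd _ dc c_x] _].
  move=> /hexagon_path[[ya' _ ab' _] [xd' _ dc' _] _] [? ?]; subst b' c'.
  by rewrite (uniq_mid _ _ _ _ ya ab ya' ab') // (uniq_mid _ _ _ _ xd dc xd' dc').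
rewrite -(card_in_imset inj); apply: eq_card => -[b c]; rewrite [RHS]inE /=.
apply/imsetP/and3P => [[[[a b'] [c' d]] + [-> ->]]|].
  rewrite inE => /hexagon_path[[ya ax ab b_y] [xd dy dc c_x] bc].
  by split=> //; apply/nbr2P; [exists a|exists d].
case=> b2 c2 bc; case/nbr2P: (b2) => a [ya ax ab b_y]; case/nbr2P: (c2) => d [xd dy dc c_x].
have cd : adj c d by rewrite adj_sym.
have dx : adj d x by rewrite adj_sym.
exists ((a, b), (c, d)); last by [].
rewrite inE /cycle_seq /ucycleb /= xy ya ab bc cd dx !inE !negb_or /=.
(* Vertices from different half trees are distinct by disjointness; the few pairs inside one half
   tree are distinct by adjacency or by the definition of [nbr2]. *)
have disj u v : u \in half_tree x y -> v \in half_tree y x -> u != v.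
  move=> uT vT; apply/eqP => uv; subst v.
  by have := disjoint_setI0 (half_tree_disjoint xy) => /setP/(_ u); rewrite in_setI uT vT inE.
have aT : a \in half_tree x y by apply/half_treeP; constructor 2.
have bT : b \in half_tree x y by apply/half_treeP; constructor 3.
have cT : c \in half_tree y x by apply/half_treeP; constructor 3.
have dT : d \in half_tree y x by apply/half_treeP; constructor 2.
have yT : y \in half_tree x y by apply/half_treeP; constructor 1.
have xT : x \in half_tree y x by apply/half_treeP; constructor 1.
rewrite (adj_neq xy) (adj_neq ya) (adj_neq ab) (adj_neq bc) (adj_neq cd) (adj_neq xd).
rewrite !(eq_sym x) ax c_x (disj b x) // (eq_sym y b) b_y (disj y c) // (disj y d) //.
by rewrite (disj a c) // (disj a d) // (disj b d).
Qed.

(** Apart from the edge to its parent, each of the [p * p] leaves near [y] has [p] edges. Each of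
    these ends at a leaf near [x], closing a hexagon, or leaves the tree. *)
Lemma hexagons_add_outside x y : adj x y ->
  #|[set t | cycle_seq (hexagon x y t)]| +
    \sum_(c in outside x y) nbr2_degree x y c = p * (p * p).
Proof.
move=> xy; rewrite card_hexagons //.
have -> : \sum_(c in outside x y) nbr2_degree x y c =
    \sum_(b in nbr2 x y) #|[set c in outside x y | adj b c]| by rewrite double_count.
rewrite -big_split /= mulnC.
rewrite -(card_nbr2 xy) -sum_nat_const; apply: eq_bigr => b b2.
have := regular b.
rewrite -(cardsID (half_tree x y)) -addn1 addnC.
have -> : [set c | adj b c] :&: half_tree x y = [set a in nbr x y | adj a b].
  apply/setP => c; rewrite in_setI [c \in [set _ | _]]inE [RHS]inE adj_sym andbC.
  by case bc: (adj c b); rewrite ?andbF // !andbT (nbr2_adj_half_tree xy b2) // adj_sym.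
rewrite card_nbr_adj // => /addIn <-.
rewrite -[RHS](cardsID (half_tree y x)); congr (_ + _); apply: eq_card => c.
  rewrite in_setI in_setD [c \in [set _ | adj _ _]]inE [LHS]inE.
  case bc: (adj b c); rewrite ?andbF //= !andbT (nbr2_adj_half_tree' xy b2) //.
  case c2: (c \in nbr2 y x); rewrite ?andbF // andbT; apply/esym/negP => cT.
  have := disjoint_setI0 (half_tree_disjoint xy) => /setP/(_ c).
  by rewrite in_setI cT (nbr2_adj_half_tree' xy b2) // c2 in_set0.
rewrite !in_setD [c \in [set _ | adj _ _]]inE [LHS]in_set in_setC in_setU negb_or.
by rewrite andbCA andbA.
Qed.

(** The leaves adjacent to [c] have distinct parents: two with the same parent [a] would form a
    quadrangle with [a] and [c]. *)
Lemma nbr2_degree_le x y c : adj x y -> c \in outside x y -> nbr2_degree x y c <= p.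
Proof.
move=> xy cW; rewrite -(card_nbr xy) -[leqLHS]muln1 -[leqRHS]muln1.
apply: (double_count_le (R := fun b a => adj a b)) => [b|a].
  by rewrite inE => /andP[b2 _]; apply: card_nbr_adj.
rewrite in_nbr => /andP[ax ya]; apply/card_le1_eqP => b b'.
rewrite !in_set => /andP[/andP[_ bc] ab] /andP[/andP[_ b'c] ab'].
apply: (@no_quadrangle a b' c b) => //; rewrite 1?adj_sym //.
apply: contraTneq cW => <-; rewrite in_setC negbK; apply/setUP; left.
by apply/half_treeP; constructor 2.
Qed.

(** The two counts concern disjoint sets of neighbours of [c], because the half trees are
    disjoint. *)
Lemma nbr2_degree_add_le x y c : adj x y -> nbr2_degree x y c + nbr2_degree y x c <= p.+1.
Proof.
move=> xy; rewrite -(regular c) -cardsUI.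
rewrite (_ : _ :&: _ = set0) ?cards0 ?addn0; last first.
  apply/setP => b; rewrite [RHS]inE; apply/negP => /setIP[].
  rewrite in_set => /andP[b2 _]; rewrite in_set => /andP[b2' _].
  have := disjoint_setI0 (half_tree_disjoint xy) => /setP/(_ b).
  rewrite in_setI in_set0 => /negbT/negP[].
  by apply/andP; split; apply/half_treeP; constructor 3.
apply: subset_leq_card; apply/subsetP => b; rewrite in_setU.
by rewrite !in_set adj_sym => /orP[] /andP[].
Qed.

Lemma two_sum_le x y e : adj x y ->
  \sum_(c in outside x y) nbr2_degree x y c = e ->
  \sum_(c in outside y x) nbr2_degree y x c = e ->
  2 * e <= #|outside x y| * p.+1.
Proof.
move=> xy; rewrite (outsideC y x) => E1 E2.
rewrite mul2n -addnn -{1}E1 -E2 -big_split /= -sum_nat_const.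
by apply: leq_sum => c _; apply: nbr2_degree_add_le.
Qed.

(** A neighbour of a leaf near [y] is three steps from [y], hence on the side opposite to [y];
    likewise for [x]. As [x] and [y] are on different sides, no [c] is adjacent to leaves of both
    kinds. *)
Lemma bipartite_two_sum_le x y e : bipartite G -> adj x y ->
  \sum_(c in outside x y) nbr2_degree x y c = e ->
  \sum_(c in outside y x) nbr2_degree y x c = e ->
  2 * e <= #|outside x y| * p.
Proof.
move=> [side sideP] xy; rewrite (outsideC y x) => E1 E2.
rewrite mul2n -addnn -{1}E1 -E2 -big_split /= -sum_nat_const.
apply: leq_sum => c cW.
have sideN u v : adj u v -> side v = ~~ side u.
  by move/sideP; case: (side u) (side v) => [] [].
have side_c u v : 0 < nbr2_degree u v c -> side c = ~~ side v.
  rewrite card_gt0 => /set0Pn[b]; rewrite in_set => /andP[/nbr2P[a [va _ ab _]] bc].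
  by rewrite (sideN _ _ bc) (sideN _ _ ab) (sideN _ _ va) negbK.
have [z1|n1] := posnP (nbr2_degree x y c).
  by rewrite z1 nbr2_degree_le ?(outsideC y) // adj_sym.
have [z2|n2] := posnP (nbr2_degree y x c); first by rewrite z2 addn0 nbr2_degree_le.
by have := sideP _ _ xy; rewrite -[side x]negbK -(side_c _ _ n2) (side_c _ _ n1) negbK eqxx.
Qed.

End GirthSix.

Lemma card_regular_even (G : sgraph) k : regular_graph G k -> ~~ odd (#|G| * k).
Proof.
move=> regular.
have -> : #|G| * k = \sum_(x in [set: G]) #|[set y in [set: G] | adj x y]|.
  rewrite -[#|G|]cardsT -sum_nat_const; apply: eq_bigr => x _; rewrite -(regular x).
  by apply: eq_card => y; rewrite !inE.
(* Orienting each edge towards the larger rank makes the degree sum twice the number of oriented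
   edges. *)
pose up (x y : G) := adj x y && (enum_rank x < enum_rank y).
suff -> : \sum_(x in [set: G]) #|[set y in [set: G] | adj x y]| =
    2 * \sum_(x in [set: G]) #|[set y in [set: G] | up x y]| by rewrite oddM.
rewrite mul2n -addnn {2}(double_count [set: G] [set: G] up) -big_split /=; apply: eq_bigr => x _.
rewrite -cardsUI (_ : _ :&: _ = set0) ?cards0 ?addn0; last first.
  by apply/setP => y; rewrite !inE /up; case: ltngtP; rewrite ?andbF.
apply: eq_card => y; rewrite !inE /up [adj y x]adj_sym -andb_orr.
case xy: (adj x y) => //=; rewrite -neq_ltn; apply/esym.
by rewrite (inj_eq val_inj) (inj_eq enum_rank_inj) adj_neq.
Qed.

(** * Projective planes and Baer subplanes *)

Lemma card_set_sig (T : finType) (A : {set T}) (P : pred T) :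
  #|[set u : {x | x \in A} | P (val u)]| = #|[set x in A | P x]|.
Proof.
rewrite -(card_imset _ val_inj); apply: eq_card => x; rewrite [RHS]inE.
apply/imsetP/andP => [[u]|[xA Px]]; first by rewrite inE => Pu ->; split=> //; apply: valP.
by exists (exist _ x xA); rewrite ?inE.
Qed.

Lemma card_sig_mem (T : finType) (A : {set T}) : #|{: {x | x \in A}}| = #|A|.
Proof. by rewrite card_sig; apply: eq_card. Qed.

(** This list of facts is symmetric in points and lines, unlike [projective_plane_of_order], which
    prescribes only the size of lines. Statements about lines then follow by passing to [dual]. *)
Record counted_plane (m : nat) (S : incidence_structure) : Prop := CountedPlane {
  join_ex : forall x y : point S, x != y -> exists l, inc x l /\ inc y l;
  meet_ex : forall l k : line S, l != k -> exists x, inc x l /\ inc x k;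
  inc_inj : forall (x y : point S) l k,
    inc x l -> inc y l -> inc x k -> inc y k -> x = y \/ l = k;
  card_line : forall l : line S, #|[set x | inc x l]| = m.+1;
  card_pencil : forall x : point S, #|[set l | inc x l]| = m.+1;
  card_points : #|{: point S}| = m ^ 2 + m + 1;
  card_lines : #|{: line S}| = m ^ 2 + m + 1
}.

Definition dual (S : incidence_structure) : incidence_structure :=
  IncidenceStructure (fun (l : line S) (x : point S) => inc x l).

Lemma counted_dual m S : counted_plane m S -> counted_plane m (dual S).
Proof.
case=> J M I L P cP cL; split=> // l k x y /= lx kx ly ky.
by case: (I _ _ _ _ lx ly kx ky) => ->; auto.
Qed.

Section CountedPlane.
Variables (m : nat) (S : incidence_structure).
Implicit Types (x y : point S) (l k : line S).

Hypothesis hS : projective_plane_of_order m S.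

Let join x y : x != y -> exists l, inc x l /\ inc y l.
Proof. by case: hS => -[J _ _] _ /J[l [xyl _]]; exists l. Qed.

Let inc_inj x y l k : inc x l -> inc y l -> inc x k -> inc y k -> x = y \/ l = k.
Proof.
case: hS => -[J _ _] _ xl yl xk yk; case: (eqVneq x y) => [|xy]; first by left.
by right; case: (J _ _ xy) => j [_ jU]; rewrite -(jU l) // -(jU k).
Qed.

Let card_join x y : x != y -> #|[set l in [set k | inc x k] | inc y l]| = 1.
Proof.
move=> xy; case: (join xy) => l [xl yl]; apply: (card_eq1 (x := l)) => [|k].
  by rewrite !inE xl.
by rewrite !inE => /andP[xk yk]; case: (inc_inj xl yl xk yk) => // E; rewrite E eqxx in xy.
Qed.

Let card_meet l k : l != k -> #|[set x in [set y | inc y l] | inc x k]| = 1.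
Proof.
move=> lk; case: hS => -[_ M _] _; case: (M _ _ lk) => x [[xl xk] xU].
apply: (card_eq1 (x := x)) => [|y]; first by rewrite !inE xl.
by rewrite !inE => /andP[yl yk]; rewrite (xU y).
Qed.

(** For [a], [b], [c] in [Q] other than [x], the lines joining [a] to [b] and to [c] cannot both
    contain [x]: they would coincide and carry three points of [Q]. *)
Let line_avoiding x : exists l, ~~ inc x l.
Proof.
case: hS => -[_ _ [Q [Q4 Qcol]]] _.
have /card_gt2P[a [b [c [[aQ bQ cQ] [ab bc ca]]]]] : 2 < #|Q :\ x|.
  by have := cardsD1 x Q; rewrite Q4; case: (x \in Q); lia.
move: aQ bQ cQ; rewrite !inE => /andP[ax aQ] /andP[_ bQ] /andP[_ cQ].
have ac : a != c by rewrite eq_sym.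
case: (join ab) => l [al bl]; case: (join ac) => k [ak ck].
case xl: (inc x l); last by exists l; rewrite xl.
case xk: (inc x k); last by exists k; rewrite xk.
have lk : l = k by case: (inc_inj xl al xk ak) => // E; rewrite E eqxx in ax.
have : [set a; b; c] \subset [set x in Q | inc x l].
  by apply/subsetP => z; rewrite !inE => /orP[/orP[]|] /eqP->; rewrite ?aQ ?bQ ?cQ // lk.
move/subset_leq_card; rewrite -setUA cardsU1 cards2 !inE negb_or ab ac bc /=.
by move/leq_trans/(_ (Qcol l)).
Qed.

(** Projection from [x] matches the lines through [x] with the points of a line that avoids [x]. *)
Let card_pencil' x : #|[set l | inc x l]| = m.+1.
Proof.
case: (line_avoiding x) => k xk; case: hS => _ /(_ k) <-.
rewrite -[LHS]muln1 -[RHS]muln1; apply/esym.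
apply: (double_count_eq (R := fun y l => inc y l)) => [y|l].
  by rewrite inE => yk; apply: card_join; apply: contraNneq xk => ->.
rewrite inE => xl; apply: card_meet; apply: contraNneq xk => ->.
exact: xl.
Qed.

Lemma counted_plane_of_order : counted_plane m S.
Proof.
case: (hS) => -[J M [Q [Q4 _]]] cl.
have [x0 _] : exists x, x \in Q by apply/set0Pn; rewrite -card_gt0 Q4.
have cP : #|{: point S}| = m ^ 2 + m + 1.
  (* The [m.+1] lines through [x0] partition the other points into classes of size [m]. *)
  have : #|~: [set x0]| * 1 = #|[set l | inc x0 l]| * m.
    apply: (double_count_eq (R := fun y l => inc y l)) => [y|l].
      by rewrite !inE eq_sym => /card_join.
    rewrite inE => x0l; have := cl l; rewrite (cardsD1 x0) inE x0l => -[<-].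
    by apply: eq_card => y; rewrite !inE.
  by rewrite card_pencil' cardsC1; have : 0 < #|point S| by [apply/card_gt0P; exists x0]; nia.
split=> //.
- by move=> l k /M[x [? _]]; exists x.
have : #|[set: point S]| * m.+1 = #|[set: line S]| * m.+1.
  apply: (double_count_eq (R := fun y l => inc y l)) => [y _|l _].
    by rewrite -(card_pencil' y); apply: eq_card => l; rewrite !inE.
  by rewrite -(cl l); apply: eq_card => y; rewrite !inE.
by move/eqP; rewrite eqn_pmul2r // !cardsT cP => /eqP.
Qed.

End CountedPlane.

Section Baer.
Variables (q : nat) (S : incidence_structure) (P0 : {set point S}) (L0 : {set line S}).
Hypothesis q_gt0 : 0 < q.
Hypothesis hS : counted_plane (q ^ 2) S.
Hypothesis hB : counted_plane q (induced P0 L0).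

Lemma baer_join x y l :
  x \in P0 -> y \in P0 -> x != y -> inc x l -> inc y l -> l \in L0.
Proof.
move=> xP yP xy xl yl.
have : exist (fun x => x \in P0) x xP != exist (fun x => x \in P0) y yP by [].
case/(join_ex hB) => -[k kL] /= [xk yk].
by case: (inc_inj hS xl yl xk yk) => [E|-> //]; rewrite E eqxx in xy.
Qed.

Lemma baer_meet x l k :
  l \in L0 -> k \in L0 -> l != k -> inc x l -> inc x k -> x \in P0.
Proof.
move=> lL kL lk xl xk.
have : exist (fun l => l \in L0) l lL != exist (fun l => l \in L0) k kL by [].
case/(meet_ex hB) => -[y yP] /= [yl yk].
by case: (inc_inj hS xl yl xk yk) => [-> //|E]; rewrite E eqxx in lk.
Qed.

Lemma card_baer_points : #|P0| = q ^ 2 + q + 1.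
Proof. by rewrite -(card_points hB) /= card_sig_mem. Qed.

Lemma card_baer_pencil x : x \in P0 -> #|[set l in L0 | inc x l]| = q.+1.
Proof. by move=> xP; rewrite -(card_pencil hB (exist _ x xP)) card_set_sig. Qed.

(** Two Baer lines would meet in a Baer point. Without any, each of the [q ^ 2 + 1] lines through
    [x] would carry at most one of the [q ^ 2 + q + 1] Baer points, although every Baer point is
    joined to [x]. *)
Lemma card_baer_lines_at x : x \notin P0 -> #|[set l in L0 | inc x l]| = 1.
Proof.
move=> xP; apply/eqP; rewrite eqn_leq; apply/andP; split.
  apply/card_le1_eqP => l k; rewrite !inE => /andP[lL xl] /andP[kL xk].
  by apply/eqP; apply: contraNT xP => lk; apply: (baer_meet kL lL).
rewrite card_gt0; apply/set0Pn.
have [l lP|no] := pickP [pred l | (l \in L0) && inc x l].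
  by exists l; rewrite inE.
suff: #|P0| * 1 <= #|[set l | inc x l]| * 1.
  by rewrite card_baer_points (card_pencil hS); lia.
apply: (double_count_le (R := fun y l => inc y l)) => [y yP|l].
  have /(join_ex hS)[l [xl yl]] : x != y by apply: contraNneq xP => ->.
  apply: (card_eq1 (x := l)); first by rewrite !inE xl.
  move=> k; rewrite !inE => /andP[xk yk].
  by case: (inc_inj hS xl yl xk yk) => [E|//]; rewrite E yP in xP.
rewrite inE => xl; apply/card_le1_eqP => y z; rewrite !inE => /andP[yP yl] /andP[zP zl].
apply/eqP; apply: contraFT (no l) => yz /=; rewrite xl andbT.
by apply: (baer_join zP yP).
Qed.

End Baer.

Section BaerDual.
Variables (q : nat) (S : incidence_structure) (P0 : {set point S}) (L0 : {set line S}).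
Hypothesis q_gt0 : 0 < q.
Hypothesis hS : counted_plane (q ^ 2) S.
Hypothesis hB : counted_plane q (induced P0 L0).

(** The structure induced on the dual is convertible to the dual of the induced one, so
    [counted_dual] applies to the subplane directly. *)
Lemma card_baer_lines : #|L0| = q ^ 2 + q + 1.
Proof. exact: (@card_baer_points q (dual S) L0 P0 (counted_dual hB)). Qed.

Lemma card_baer_points_on l : l \notin L0 -> #|[set x in P0 | inc x l]| = 1.
Proof.
exact: (@card_baer_lines_at q (dual S) L0 P0 q_gt0 (counted_dual hS) (counted_dual hB)).
Qed.
End BaerDual.

(** Here [p] is the degree minus one, [p * (p - q)] the number of edges leaving the tree at the
    leaves of one side, and [2 * (p - q)] the number of outside vertices in the Baer graph. The
    additive form lets the cycle count be cancelled. *)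
Lemma baer_arith q : 1 < q -> exists p,
  [/\ q ^ 2 = p.+1, q < p, 0 < (q ^ 2 - 1) * (q ^ 4 - 3 * q ^ 2 + q + 2),
      (q ^ 2 - 1) * (q ^ 4 - 3 * q ^ 2 + q + 2) + p * (p - q) = p * (p * p) &
      2 * (q ^ 4 - q) = 2 * (1 + p + p * p) + 2 * (p - q)].
Proof.
move=> q1; have q2 : q * 2 <= q ^ 2 by rewrite expnS expn1 leq_mul2l q1 orbT.
exists (q ^ 2).-1; have -> : q ^ 4 = q ^ 2 * q ^ 2 by rewrite -expnD.
(* [q ^ 2] is generalised; all that is kept about the square is [q * 2 <= q ^ 2]. *)
case: (q ^ 2) q2 => [|p] q2 /=; first by lia.
have qp : q < p by lia.
split=> //; rewrite ?subn1 /=.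
- by rewrite muln_gt0 addn_gt0 orbT andbT; lia.
- rewrite -mulnDr; congr (_ * _); rewrite mulSn mulnS.
  by have : 3 * p <= p * p; [rewrite leq_mul2r|]; lia.
- by rewrite mulSn mulnS; lia.
Qed.

(** * The Baer graph *)

Section BaerGraph.
Variables (q : nat) (S : incidence_structure) (P0 : {set point S}) (L0 : {set line S}).
Hypothesis q_gt1 : 1 < q.
Hypothesis hS : counted_plane (q ^ 2) S.
Hypothesis hB : counted_plane q (induced P0 L0).

Notation vert := ({x : point S | x \in ~: P0} + {l : line S | l \in ~: L0})%type.

Definition baer_adj (u v : vert) : bool :=
  match u, v with
  | inl x, inr l => inc (val x) (val l)
  | inr l, inl x => inc (val x) (val l)
  | _, _ => false
  end.

Lemma baer_adj_sym : symmetric baer_adj.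
Proof. by move=> [x|l] [y|k]. Qed.

Lemma baer_adj_irrefl : irreflexive baer_adj.
Proof. by move=> [x|l]. Qed.

Definition baer_graph : sgraph := SGraph baer_adj_sym baer_adj_irrefl.

Lemma baer_bipartite : bipartite baer_graph.
Proof. by exists (fun u : vert => if u is inl _ then true else false); case=> [x|l] [y|k]. Qed.

Let q_gt0 : 0 < q. Proof. exact: ltnW. Qed.

Let notin_P0 (x : {x : point S | x \in ~: P0}) : val x \notin P0.
Proof. by have := valP x; rewrite inE. Qed.

Let notin_L0 (l : {l : line S | l \in ~: L0}) : val l \notin L0.
Proof. by have := valP l; rewrite inE. Qed.

Lemma card_baer_graph : #|baer_graph| = 2 * (q ^ 4 - q).
Proof.
rewrite card_sum !card_sig_mem (cardsCs (~: P0)) (cardsCs (~: L0)) !setCK.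
rewrite (card_points hS) (card_lines hS).
rewrite (card_baer_points hB) (card_baer_lines hB).
by rewrite (expnM q 2 2); move: ((q ^ 2) ^ 2) (q ^ 2) => *; lia.
Qed.

Lemma baer_regular : regular_graph baer_graph (q ^ 2).
Proof.
have inl_inj : injective (@inl {x : point S | x \in ~: P0} {l : line S | l \in ~: L0}).
  by move=> ? ? [].
have inr_inj : injective (@inr {x : point S | x \in ~: P0} {l : line S | l \in ~: L0}).
  by move=> ? ? [].
case=> [x|l].
  rewrite (_ : [set y | _] = inr @: [set l : {l | l \in ~: L0} | inc (val x) (val l)]).
    rewrite card_imset // (card_set_sig (~: L0) (fun l => inc (val x) l)).
    have := card_pencil hS (val x); rewrite -(cardsID L0).
    rewrite (_ : _ :&: _ = [set l in L0 | inc (val x) l]); last first.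
      by apply/setP => l; rewrite !inE andbC.
    rewrite (card_baer_lines_at q_gt0 hS hB) // => -[<-].
    by apply: eq_card => l; rewrite !inE.
  apply/setP => -[y|l]; rewrite inE /=.
    by apply/esym/imsetP => -[].
  by rewrite mem_imset // inE.
rewrite (_ : [set y | _] = inl @: [set x : {x | x \in ~: P0} | inc (val x) (val l)]).
  rewrite card_imset // (card_set_sig (~: P0) (fun x => inc x (val l))).
  have := card_line hS (val l); rewrite -(cardsID P0).
  rewrite (_ : _ :&: _ = [set x in P0 | inc x (val l)]); last first.
    by apply/setP => x; rewrite !inE andbC.
  rewrite (card_baer_points_on q_gt0 hS hB) // => -[<-].
  by apply: eq_card => x; rewrite !inE.
apply/setP => -[x|k]; rewrite inE /=.
  by rewrite mem_imset // inE.
by apply/esym/imsetP => -[].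
Qed.

(** Lengths 3 and 5 contradict the alternation of points and lines; length 4 would put two points on
    two common lines. *)
Lemma baer_girth_ge6 (s : seq baer_graph) : cycle_seq s -> 6 <= size s.
Proof.
have two (x y : {x : point S | x \in ~: P0}) (l k : {l : line S | l \in ~: L0}) :
    inc (val x) (val l) -> inc (val y) (val l) -> inc (val x) (val k) ->
    inc (val y) (val k) -> (x == y) || (l == k).
  move=> xl yl xk yk; case: (inc_inj hS xl yl xk yk) => /val_inj ->; rewrite eqxx ?orbT //.
rewrite leqNgt; apply: contraTN.
case: s => [|a [|b [|c [|d [|e [|f s]]]]]] //= _; rewrite /cycle_seq /ucycleb /=.
- by case: a b c => [a|a] [b|b] [c|c] //=; rewrite ?andbF.
- case: a b c d => [a|a] [b|b] [c|c] [d|d] //=; rewrite ?andbF ?andbT // !inE /=.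
    apply/negP => /andP[/and4P[ab cb cd ad] /andP[/norP[ac _] bd]].
    by case/orP: (two _ _ _ _ ab cb ad cd) => /eqP E;
      [rewrite E eqxx in ac|rewrite E eqxx in bd].
  apply/negP => /andP[/and4P[ba bc dc da] /andP[/norP[ac _] bd]].
  by case/orP: (two _ _ _ _ ba da bc dc) => /eqP E;
    [rewrite E eqxx in bd|rewrite E eqxx in ac].
by case: a b c d e => [a|a] [b|b] [c|c] [d|d] [e|e] //=; rewrite ?andbF.
Qed.

Let pointV x : x \notin P0 -> exists x' : {x | x \in ~: P0}, val x' = x.
Proof. by rewrite -in_setC => xP; exists (exist _ x xP). Qed.

Let lineV l : l \notin L0 -> exists l' : {l | l \in ~: L0}, val l' = l.
Proof. by rewrite -in_setC => lL; exists (exist _ l lL). Qed.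

Lemma baer_nbr_ex (u v : baer_graph) : exists w, adj u w /\ w != v.
Proof.
have [p [q2 qp _ _ _]] := baer_arith q_gt1.
have := cardsD1 v [set w | adj u w]; rewrite baer_regular q2 => E.
have : 0 < #|[set w | adj u w] :\ v| by case: (v \in _) E; lia.
by rewrite card_gt0 => /set0Pn[w]; rewrite !inE => /andP[]; exists w.
Qed.

Lemma baer_connected : connected_graph baer_graph.
Proof.
have csym : connect_sym (@adj baer_graph) by apply: sym_connect_sym; apply: adj_sym.
have pts (x y : {x | x \in ~: P0}) : connect (@adj baer_graph) (inl x) (inl y).
  have [->|xy] := eqVneq x y; first exact: connect0.
  have vxy : val x != val y by [].
  case: (join_ex hS vxy) => l [xl yl].
  case lL: (l \in L0); last first.
    case/negbT/lineV: lL => l' E; subst l.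
    by apply: (connect_trans (y := inr l')); apply: connect1.
  (* The line joining [x] and [y] was deleted, so the path detours through another point [z] of a
     remaining line [k] at [x]. The line from [z] to [y] remains, since the only Baer line at [y] is
     [l], which misses [z]. *)
  case: (baer_nbr_ex (inl x) (inl x)) => -[? []|k [/= xk _]] //.
  case: (baer_nbr_ex (inr k) (inl x)) => -[z [/= zk zx]|? []] //.
  have {}zx : val z != val x by [].
  have kl : val k <> l by move=> E; have := notin_L0 k; rewrite E lL.
  have zy : val z != val y.
    apply: contra_not_neq kl => E; rewrite E in zk.
    by case: (inc_inj hS xl yl xk zk) => // xyE; rewrite xyE eqxx in vxy.
  case: (join_ex hS zy) => n [zn yn].
  have nL : n \notin L0.
    apply/negP => nL; case: (eqVneq n l) => [E|nl].
      subst n; case: (inc_inj hS xl zn xk zk) => E; last by apply: kl.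
      by rewrite E eqxx in zx.
    by have := notin_P0 y; rewrite (baer_meet hS hB nL lL nl yn yl).
  case/lineV: nL => n' E; subst n.
  apply: (connect_trans (y := inr k)); first exact: connect1.
  apply: (connect_trans (y := inl z)); first exact: connect1.
  by apply: (connect_trans (y := inr n')); apply: connect1.
have all_pts (u : baer_graph) : exists x, connect (@adj baer_graph) u (inl x).
  case: u => [x|l]; first by exists x; apply: connect0.
  by case: (baer_nbr_ex (inr l) (inr l)) => -[x [lx _]|? []] //; exists x; apply: connect1.
move=> u v; case: (all_pts u) => x ux; case: (all_pts v) => y vy.
by apply: (connect_trans ux); apply: (connect_trans (pts x y)); rewrite csym.
Qed.

(* A line [c] outside both half trees meets [l] in the Baer point [b] of [l], and
   exactly one non-Baer point of such a [c] is joined to [x] by a Baer line. *)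
Lemma baer_sum_outside (x : {x | x \in ~: P0}) (l : {l | l \in ~: L0}) :
  inc (val x) (val l) ->
  \sum_(c in @outside baer_graph (inr l) (inl x)) @nbr2_degree baer_graph (inr l) (inl x) c =
    (q ^ 2 - 1) * (q ^ 2 - 1 - q).
Proof.
move=> xl; have q2_gt0 : 0 < q ^ 2 by rewrite expn_gt0 q_gt0.
have /eqP/cards1P[b bE] := card_baer_points_on q_gt0 hS hB (notin_L0 l).
have inbE z : (z \in P0) && inc z (val l) = (z == b).
  by rewrite -[z == b]in_set1 -bE inE.
have /andP[bP bl] : (b \in P0) && inc b (val l) by rewrite inbE.
have xb : val x != b by apply: contraNneq (notin_P0 x) => ->.
have /eqP/cards1P[k kE] := card_baer_lines_at q_gt0 hS hB (notin_P0 x).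
have inkE j : (j \in L0) && inc (val x) j = (j == k).
  by rewrite -[j == k]in_set1 -kE inE.
have /andP[kL xk] : (k \in L0) && inc (val x) k by rewrite inkE.
(* [C] will turn out to be the set of outside vertices that have a neighbour among the leaves near
   [x]; each has [q ^ 2 - 1] of them. *)
pose C : {set baer_graph} := inr @: [set c : {l | l \in ~: L0} | inc b (val c) && (val c != val l)].
have CP c : reflect (exists2 c', c = inr c' & inc b (val c') /\ val c' != val l) (c \in C).
  apply: (iffP imsetP) => [[c'] | [c' -> [bc cl]]].
    by rewrite inE => /andP[bc cl] ->; exists c'.
  by exists c'; rewrite // inE bc cl.
have nbr2xP (c : baer_graph) : reflect
    (exists y j, [/\ c = inl y, inc (val x) (val j), inc (val y) (val j), j != l & y != x])
    (c \in @nbr2 baer_graph (inr l) (inl x)).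
  apply: (iffP (nbr2P _ _ _)) => [[[?|j] [/= xj jl jy yx]] //|[y [j [-> xj yj jl yx]]]].
    by case: c jy yx => [y|? //=] yj yx; exists y, j.
  by exists (inr j).
have nbr2lP (c : baer_graph) : reflect
    (exists j y, [/\ c = inr j, inc (val y) (val l), inc (val y) (val j), j != l & y != x])
    (c \in @nbr2 baer_graph (inl x) (inr l)).
  apply: (iffP (nbr2P _ _ _)) => [[[y|?] [/= yl yx yj jl]] //|[j [y [-> yl yj jl yx]]]].
    by case: c yj jl => [? //=|j] yj jl; exists j, y.
  by exists (inl y).
have C_outside : C \subset @outside baer_graph (inr l) (inl x).
  apply/subsetP => c /CP[c' -> [bc cl]]; rewrite in_setC in_setU negb_or.
  apply/andP; split; apply/half_treeP => -[//|[/= xc _]|].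
  - by case: (inc_inj hS xl bl xc bc) => E; [rewrite E eqxx in xb|rewrite E eqxx in cl].
  - by case/nbr2xP => y [j []].
  - by case=> E; rewrite E eqxx in cl.
  - by [].
  case/nbr2lP => j [y [[<-] yl yc _ _]].
  case: (inc_inj hS yl bl yc bc) => E; last by rewrite E eqxx in cl.
  by have := notin_P0 y; rewrite E bP.
have cardC : #|C| = q ^ 2 - 1 - q.
  rewrite card_imset; last by move=> ? ? [].
  rewrite (@card_set_sig _ (~: L0) (fun c => inc b c && (c != val l))).
  have := card_pencil hS b; rewrite -(cardsID L0) (cardsD1 (val l) (_ :\: L0)).
  rewrite (_ : _ :&: _ = [set c in L0 | inc b c]); last first.
    by apply/setP => c; rewrite !inE andbC.
  rewrite (card_baer_pencil hB bP) !inE bl (notin_L0 l) /=.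
  rewrite (_ : _ :\ _ = [set c in ~: L0 | inc b c && (c != val l)]); first by move=> /=; lia.
  by apply/setP => c; rewrite !inE; case: (c \in L0); case: (inc b c); case: (c == _).
(* A remaining line other than [l] that misses [b] meets [l] in a remaining point, so it lies in one
   of the half trees and is not outside. *)
rewrite (big_setID C) /= (setIidPr C_outside) [X in _ + X]big1 ?addn0; last first.
  move=> c /setDP[cW cC]; apply/eqP; rewrite cards_eq0 -subset0; apply/subsetP => d.
  rewrite in_set => /andP[/nbr2xP[y [j [-> xj yj jl yx]]]].
  case: c cW cC => [? //=|c] cW cC yc.
  move: cW; rewrite in_setC in_setU negb_or => /andP[/negP Wx /negP Wl].
  have cl : val c != val l.
    by apply/negP => /eqP/val_inj E; case: Wl; apply/(@half_treeP baer_graph); rewrite E; constructor 1.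
  case: (meet_ex hS cl) => z [zc zl]; case: (boolP (z \in P0)) => zP.
    case/negP: cC; apply/CP; exists c => //; split=> //.
    by have := inbE z; rewrite zP zl => /esym/eqP <-.
  case/pointV: zP => z' zE; subst z.
  case: (eqVneq z' x) => [E|zx]; first subst z'.
    by case: Wx; apply/(@half_treeP baer_graph); constructor 2; split=> //; apply: contraNneq cl => -[->].
  by case: Wl; apply/(@half_treeP baer_graph); constructor 3; apply/nbr2lP; exists c, z'.
have -> : q ^ 2 - 1 - q = #|C| by [].
rewrite mulnC -sum_nat_const; apply: eq_bigr => c /CP[{}c -> [bc cl]].
have kc : val c != k by apply: contraTneq kL => <-; apply: notin_L0.
(* [z] is the one neighbour of [c] that is not a leaf near [x], as its line to [x] is the deleted
   [k]. It is not a Baer point: the only one on [c] is [b], whose line to [x] is [l]. *)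
case: (meet_ex hS kc) => z [zc zk].
have zP : z \notin P0.
  apply/negP => zP; have /eqP zb : z == b.
    have /eqP/cards1P[b' b'E] := card_baer_points_on q_gt0 hS hB (notin_L0 c).
    have : z \in [set b'] by rewrite -b'E inE zP.
    have : b \in [set b'] by rewrite -b'E inE bP.
    by rewrite !in_set1 => /eqP-> /eqP->.
  subst z; case: (inc_inj hS xl bl xk zk) => E; first by rewrite E eqxx in xb.
  by have := notin_L0 l; rewrite E kL.
case/pointV: zP => z' zE; subst z.
have := @baer_regular (inr c); rewrite (cardsD1 (inl z')) inE /= zc => <-.
rewrite add1n subn1 /=; apply: eq_card => d; rewrite in_setD1 [X in _ && X]in_set [LHS]in_set.
have xc : ~~ inc (val x) (val c).
  apply/negP => xc; case: (inc_inj hS xl bl xc bc) => E; first by rewrite E eqxx in xb.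
  by rewrite E eqxx in cl.
apply/andP/andP => [[/nbr2xP[y [j [-> xj yj jl yx]]] yc]|[]].
  split; last by [].
  apply/eqP => -[E]; subst z'; case: (inc_inj hS xk zk xj yj) => E.
    by move/val_inj: E => E; rewrite E eqxx in yx.
  by have := notin_L0 j; rewrite -E kL.
case: d => [y|? //=] yz yc; split; last by [].
have yx : val y != val x by apply: contraNneq xc => <-.
case: (join_ex hS yx) => j [yj xj].
have jL : j \notin L0.
  apply/negP => jL; have /eqP E : j == k by rewrite -inkE jL.
  subst j; case: (inc_inj hS yj zk yc zc) => E; last by rewrite E eqxx in kc.
  by move/val_inj: E => E; rewrite E eqxx in yz.
case/lineV: jL => j' jE; subst j; apply/nbr2xP; exists y, j'; split=> //.
apply/eqP => E; subst j'; case: (inc_inj hS yj bl yc bc) => E.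
  by have := notin_P0 y; rewrite E bP.
by rewrite E eqxx in cl.
Qed.

Lemma baer_egr :
  egr baer_graph (2 * (q ^ 4 - q)) (q ^ 2) 6 ((q ^ 2 - 1) * (q ^ 4 - 3 * q ^ 2 + q + 2)).
Proof.
have [p [q2 qp lam_gt0 lamE ordE]] := baer_arith q_gt1.
have regular : regular_graph baer_graph p.+1 by rewrite -q2; apply: baer_regular.
have hexagons (x : {x | x \in ~: P0}) (l : {l | l \in ~: L0}) : inc (val x) (val l) ->
    #|[set t | cycle_seq (@hexagon baer_graph (inr l) (inl x) t)]| =
    (q ^ 2 - 1) * (q ^ 4 - 3 * q ^ 2 + q + 2).
  move=> xl; have := hexagons_add_outside baer_girth_ge6 regular (x := inr l) (y := inl x) xl.
  rewrite baer_sum_outside // -lamE [X in X - 1 - q]q2.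
  by rewrite [X in _ + (X - 1) * _]q2 subn1 => /addIn.
have [u [v uv]] : exists u v : baer_graph, adj u v.
  have : 0 < #|baer_graph| by rewrite card_baer_graph ordE.
  by case/card_gt0P => u _; case: (baer_nbr_ex u u) => v [uv _]; exists u, v.
have lam (w z : baer_graph) : adj w z ->
    #|[set C in cycles_of_length baer_graph 6 | [set w; z] \in C]| =
    (q ^ 2 - 1) * (q ^ 4 - 3 * q ^ 2 + q + 2).
  case: w z => [x|l] [y|k] // wz; last by rewrite card_cycles_of_length6 hexagons.
  by rewrite setUC card_cycles_of_length6 hexagons.
split=> //; [exact: baer_connected|exact: card_baer_graph|exact: baer_regular|split].
  (* Positivity of the cycle count supplies a hexagon, so girth 6 is attained. *)
  have : 0 < #|[set C in cycles_of_length baer_graph 6 | [set u; v] \in C]|.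
    by rewrite lam.
  rewrite card_cycles_of_length6 card_gt0 => /set0Pn[t]; rewrite inE => t_cyc.
  by exists (hexagon u v t).
exact: baer_girth_ge6.
Qed.

End BaerGraph.

(** * Lower bounds on the order *)

Section LowerBounds.
Variables (q m : nat) (H : sgraph).
Hypothesis q_gt1 : 1 < q.
Hypothesis egrH : egr H m (q ^ 2) 6 ((q ^ 2 - 1) * (q ^ 4 - 3 * q ^ 2 + q + 2)).

Let girth6 (s : seq H) : cycle_seq s -> 6 <= size s.
Proof. by case: egrH => _ _ _ [_ g] _; apply: g. Qed.

Let edge_ex : exists x y : H, adj x y.
Proof.
case: egrH => _ _ r [[[|x s] []] //] _ _ _ _.
have : 0 < #|[set y | adj x y]| by rewrite r expn_gt0 ltnW.
by rewrite card_gt0 => /set0Pn[y]; rewrite inE; exists x, y.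
Qed.

(** Cancelling the cycle count in [hexagons_add_outside] shows that the number of leaving edges is
    forced by the parameters. *)
Let sum_outside p (x y : H) : q ^ 2 = p.+1 -> adj x y ->
  (q ^ 2 - 1) * (q ^ 4 - 3 * q ^ 2 + q + 2) + p * (p - q) = p * (p * p) ->
  \sum_(c in outside x y) nbr2_degree x y c = p * (p - q).
Proof.
case: egrH => _ _ r _ lamE q2 xy; have regular : regular_graph H p.+1 by rewrite -q2.
rewrite -(hexagons_add_outside girth6 regular xy) -card_cycles_of_length6 (lamE _ _ xy).
by move/addnI.
Qed.

Lemma bipartite_egr_order_ge : bipartite H -> 2 * (q ^ 4 - q) <= m.
Proof.
move=> bip; case: edge_ex => x [y xy]; have yx : adj y x by rewrite adj_sym.
have [p [q2 qp _ lamE ->]] := baer_arith q_gt1.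
case: egrH => _ <- r _ _; have regular : regular_graph H p.+1 by rewrite -q2.
have := bipartite_two_sum_le girth6 regular bip xy (sum_outside q2 xy lamE)
  (sum_outside q2 yx lamE).
rewrite (card_outside girth6 regular xy) leq_add2l.
(* Both sides of the edge count carry a factor [p], which is positive and cancels. *)
by rewrite mulnCA [#|_| * p]mulnC leq_pmul2l // (leq_ltn_trans _ qp).
Qed.

(* Without bipartiteness the count alone leaves the order [2 * (q ^ 4 - q) - 1] open;
   it is excluded because a regular graph of odd degree has even order. *)
Lemma odd_egr_order_ge : odd q -> 2 * (q ^ 4 - q) <= m.
Proof.
move=> q_odd; case: edge_ex => x [y xy]; have yx : adj y x by rewrite adj_sym.
have [p [q2 qp _ lamE ->]] := baer_arith q_gt1.
case: egrH => _ <- r _ _; have regular : regular_graph H p.+1 by rewrite -q2.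
have := two_sum_le girth6 regular xy (sum_outside q2 xy lamE) (sum_outside q2 yx lamE).
have := card_regular_even regular; rewrite -q2 oddM oddX q_odd orbT andbT q2.
rewrite (card_outside girth6 regular xy) leq_add2l oddD oddM /=.
move: #|_| => w w_even w_le; rewrite leqNgt; apply/negP => w_lt.
(* Parity lowers the bound on [w] by one more. Times [p.+1], the new bound falls short of
   [2 * (p * (p - q))] by [2 * (q + 1)]. *)
have {}w_lt : w <= 2 * (p - q) - 2 by lia.
have : w * p.+1 <= (2 * (p - q) - 2) * p.+1 by rewrite leq_mul2r w_lt orbT.
move/(leq_trans w_le); have: 0 < p - q <= p by lia.
by case: (p - q) => // d d_lt; rewrite !mulnS mulnDr mulnA; lia.
Qed.

End LowerBounds.

(* For q >= 2 the truncated subtractions below are exact. *)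
Theorem theorem2p3 (q : nat) (hq : 2 <= q)
    (Pi : incidence_structure) (hPi : projective_plane_of_order (q ^ 2) Pi)
    (hB : exists (P0 : {set point Pi}) (L0 : {set line Pi}),
        subplane_of_order q P0 L0) :
  exists G : sgraph,
    extremal_bipartite_egr G (2 * (q ^ 4 - q)) (q ^ 2) 6
      ((q ^ 2 - 1) * (q ^ 4 - 3 * q ^ 2 + q + 2)) /\
    (odd q ->
     extremal_egr G (2 * (q ^ 4 - q)) (q ^ 2) 6
       ((q ^ 2 - 1) * (q ^ 4 - 3 * q ^ 2 + q + 2))).
Proof.
case: hB => P0 [L0 /counted_plane_of_order hB].
have hS := counted_plane_of_order hPi.
have bip := baer_bipartite P0 L0; have G_egr := baer_egr hq hS hB.
exists (baer_graph P0 L0); split=> [|q_odd].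
  split=> //; split; first by exists (baer_graph P0 L0).
  by move=> m [H [H_bip H_egr]]; exact: (bipartite_egr_order_ge hq H_egr H_bip).
split=> //; split; first by exists (baer_graph P0 L0).
by move=> m [H H_egr]; exact: (odd_egr_order_ge hq H_egr q_odd).
Qed.
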